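(* Let $N(\cdot)$ be a counting process with counting times $0=t_0<t_1<\cdots$, inter-arrival times $T_n=t_n-t_{n-1}$, residual time process $R(\cdot)$ and $X(t)=(N(t),R(t))$, and let $\mathbb{F}=\{\mathcal{F}_t;t\ge0\}$ be a filtration such that $\sigma(\{X(u);u\le t\})\subset\mathcal{F}_t$ for all $t\ge0$. Assume that $X(0)=(1,T_1)$ (i.e. $t_0=0$), that $T_n>0$ almost surely and $\mathbb{E}[T_n]<\infty$ for all $n\ge1$, and that $\mathbb{E}[N(t)]<\infty$ for all finite $t\ge0$. For $v>0$ put $T^{(v)}_n=T_n\wedge v$, $R^{(v)}(t)=R(t)\wedge v$, and $$\widetilde\lambda^{(v)}(t)=\frac1{\mathbb{E}[T^{(v)}_n\mid\mathcal{F}_{t_{n-1}-}]},\qquad t\in[t_{n-1},t_n),\ n=1,2,\ldots.$$ Then for each $v>0$, $$N(t)=\int_0^t\widetilde\lambda^{(v)}(s)\,1\big(R(s)\le v\big)\,ds+\widetilde\lambda^{(v)}(t)R^{(v)}(t)+M^{(v)}(t),\qquad t\ge0,$$ where $$M^{(v)}(t)=\sum_{n=1}^{N(t)}\big(1-\widetilde\lambda^{(v)}(t_{n-1})\,T^{(v)}_n\big),\qquad t\ge0,$$ is an $\mathbb{F}$-martingale.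
   Context: A counting process $N(\cdot)=\{N(t);t\ge0\}$ is a non-negative integer-valued process such that $N(t)$ is finite, nondecreasing and right-continuous with left-hand limits, and $N(t)-N(t-)\le1$ for all $t\ge0$, where $N(0-)=0$. Its counting times are $t_{n-1}=\inf\{t\ge0;\,n\le N(t)\}$, $n\ge1$. Since $t_0=0$, we have $N(0)=1$, and $n\le N(t)$ if and only if $t_{n-1}\le t$. For $n\ge1$, $T_n=t_n-t_{n-1}$. The residual time to the next counting instant is $R(t)=\sum_{\ell=1}^{N(t)}T_\ell-t$ for $t\ge0$ (so $R(t)=t_n-t$ for $t_{n-1}\le t<t_n$, and $R(t_n)=T_{n+1}$). For an $\mathbb{F}$-stopping time $\tau$, $\mathcal{F}_{\tau-}=\sigma(\{A\cap\{t<\tau\};A\in\mathcal{F}_t,t\ge0\})$; in particular $\mathcal{F}_{t_0-}$ is trivial when $t_0=0$. Each $t_n$ is an $\mathbb{F}$-stopping time. $1(\cdot)$ is the indicator function and $a\wedge b=\min(a,b)$. *)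

(* Defs.v *)
From HB Require Import structures.
From mathcomp Require Import all_boot all_order all_algebra.
From mathcomp Require Import all_classical all_reals all_analysis.
From mathcomp Require Import measurable_realfun.
Set Implicit Arguments.
Unset Strict Implicit.
Unset Printing Implicit Defensive.
Import Order.TTheory GRing.Theory Num.Theory.
Import numFieldNormedType.Exports.
Local Open Scope classical_set_scope.
Local Open Scope ring_scope.

(** Processes are functions of time [t : R] first and outcome [w] second; only
    their values at times [0 <= t] matter. *)

Section CountingProcess.
Context {T : Type} {R : realType}.
Implicit Types (N : R -> T -> nat) (t v : R) (w : T) (n : nat).

(** N(t-), with the convention N(0-) = 0.  Values are cast to [R] so that the
    jump N(t) - N(t-) is not a truncated subtraction. *)
Definition left_value N t w : R :=
  if t <= 0 then 0 else lim (((N s w)%:R : R) @[s --> t^'-]).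

Definition counting_process N : Prop := forall w,
  [/\ forall s t : R, 0 <= s -> s <= t -> (N s w <= N t w)%N,
      forall t, 0 <= t -> ((N s w)%:R : R) @[s --> t^'+] --> ((N t w)%:R : R),
      forall t, 0 < t -> cvg (((N s w)%:R : R) @[s --> t^'-])
    & forall t, 0 <= t -> (N t w)%:R - left_value N t w <= 1].

(** The n-th counting time t_n, [+oo] if there are at most n counting times. *)
Definition counting_time N n w : \bar R :=
  ereal_inf [set t%:E | t in [set t : R | 0 <= t /\ (n.+1 <= N t w)%N]].

(** T_n, for n >= 1; it is [+oo - +oo = -oo] where t_{n-1} = t_n = +oo. *)
Definition interarrival N n w : \bar R :=
  (counting_time N n w - counting_time N n.-1 w)%E.

Definition residual N t w : \bar R :=
  (\sum_(1 <= l < (N t w).+1) interarrival N l w - t%:E)%E.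

(** X(t) = (N(t), R(t)) *)
Definition state N t w : nat * \bar R := (N t w, residual N t w).

(** The truncations at v are real-valued: a minimum with [v%:E] is never
    [+oo], and [fine] only matters where it is [-oo]. *)
Definition trunc_interarrival N v n w : R :=
  fine (Order.min (interarrival N n w) v%:E).

Definition trunc_residual N v t w : R :=
  fine (Order.min (residual N t w) v%:E).

(** The intervals [t_{n-1}, t_n) cover [0, +oo), so [lam] is determined there.
    A version [C n] of a conditional expectation may vanish on a null set, where
    [1 / C n w] is 0. *)
Definition reciprocal_intensity N (C : nat -> T -> R) (lam : R -> T -> R) :=
  forall n t w, (0 < n)%N ->
    (counting_time N n.-1 w <= t%:E)%E -> (t%:E < counting_time N n w)%E ->
    lam t w = 1 / C n w.

(** M^(v); the counting times t_{n-1} with n <= N(t) are finite. *)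
Definition counting_martingale N v (lam : R -> T -> R) t w : R :=
  \sum_(1 <= n < (N t w).+1)
    (1 - lam (fine (counting_time N n.-1 w)) w * trunc_interarrival N v n w).

End CountingProcess.

Section Filtrations.
Context {d : measure_display} {T : measurableType d} {R : realType}.
Implicit Types (F : R -> set (set T)) (G : set (set T)).

Definition filtration F : Prop :=
  [/\ forall t : R, 0 <= t -> sigma_algebra setT (F t),
      forall t : R, 0 <= t -> F t `<=` measurable
    & forall s t : R, 0 <= s -> s <= t -> F s `<=` F t].

(** sigma(X(u); 0 <= u <= t) *)
Definition natural_sigma_algebra {d'} {S : measurableType d'}
    (X : R -> T -> S) (t : R) : set (set T) :=
  <<s [set A | exists u B,
        [/\ 0 <= u, u <= t, measurable B & A = X u @^-1` B]] >>.

(** F_{tau-} *)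
Definition strict_past F (tau : T -> \bar R) : set (set T) :=
  <<s [set B | exists t A,
        [/\ 0 <= t, F t A & B = A `&` [set w | (t%:E < tau w)%E]]] >>.

(** [Y] is a version of E[X | G], for a sub-sigma-algebra [G]. *)
Definition cond_expectation (P : probability T R) G (X Y : T -> R) : Prop :=
  [/\ forall B : set R, measurable B -> G (Y @^-1` B),
      P.-integrable setT (EFin \o Y)
    & forall A, G A ->
        (\int[P]_(w in A) (Y w)%:E = \int[P]_(w in A) (X w)%:E)%E].

Definition martingale (P : probability T R) F (M : R -> T -> R) : Prop :=
  [/\ forall t, 0 <= t -> forall B : set R, measurable B -> F t (M t @^-1` B),
      forall t, 0 <= t -> P.-integrable setT (EFin \o M t)
    & forall s t, 0 <= s -> s <= t -> cond_expectation P (F s) (M t) (M s)].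

End Filtrations.

(* Main.v *)
(* On [t_{n-1}, t_n), the intensity is the constant 1/C_n and R(s) = t_n - s, so
   the part of this interval on which R(s) <= v has length T_n^(v); up to time t
   the last such part is cut short by R^(v)(t). This gives the decomposition
   pathwise.

   For the martingale property, M^(v)(t) is the sum over n of D_n 1(t_{n-1} <= t)
   with D_n = 1 - T_n^(v)/C_n. Since C_n > 0 almost surely, 1/C_n can be taken out
   of the conditional expectation, so D_n has integral 0 over every set A of
   F_{t_{n-1}-}, while |D_n| has integral at most 2 P(A). The latter makes
   the series converge in L^1, with norm at most 2 E[N(t)]; the former applies to
   A /\ {s < t_{n-1} <= t} for A in F_s, so the terms indexed by
   N(s) < n <= N(t) do not contribute to the integral of M^(v)(t) over A. *)
Require Import Defs.
From mathcomp Require Import all_boot all_order all_algebra.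
From mathcomp Require Import all_classical all_reals all_analysis.
From mathcomp Require Import measurable_realfun.
From mathcomp Require Import ring lra.
Import Order.TTheory GRing.Theory Num.Theory.
Import numFieldNormedType.Exports.
Local Open Scope classical_set_scope.
Local Open Scope ring_scope.

Set Implicit Arguments.
Unset Strict Implicit.
Unset Printing Implicit Defensive.

(** * Counting times along a path and the pathwise decomposition *)

Section Paths.
Context {T : Type} {R : realType}.
Variable N : R -> T -> nat.
Hypothesis hN : counting_process N.
Implicit Types (s t v : R) (w : T) (n : nat).

Lemma counting_time_ge0 n w : (0 <= counting_time N n w)%E.
Proof. by apply: le_ereal_inf_tmp => _ [t [t0 _] <-]; rewrite lee_fin. Qed.

(* By right-continuity, the infimum defining [t_n] is attained. *)
Lemma counting_time_le n t w : 0 <= t ->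
  (counting_time N n w <= t%:E)%E = (n < N t w)%N.
Proof.
move=> t0; have [mono rcont _ _] := hN w.
apply/idP/idP => [tn_t|nNt]; last by apply: ereal_inf_lbound; exists t.
rewrite ltnNge; apply/negP => Ntn.
(* If [N t w <= n], right-continuity with tolerance 1 keeps the integer [N] constant up to some
   [s > t], so the infimum is at least [s]. *)
have [s [ts Nst]] : exists s, t < s /\ N s w = N t w.
  suff : \forall s \near t^'+, t < s /\ N s w = N t w by move/filter_ex.
  near=> s; have ts : t < s by near: s; exact: nbhs_right_gt.
  split=> //; apply/eqP; rewrite eqn_leq (mono _ _ t0 (ltW ts)) andbT -ltnS.
  rewrite -(ltr_nat R) -natr1 -ltrBlDl; apply: le_lt_trans (ler_norm _) _.
  rewrite distrC.
  near: s; move/cvgrPdist_lt: (rcont _ t0) => /(_ 1 ltr01); exact.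
have : (s%:E <= counting_time N n w)%E.
  apply: le_ereal_inf_tmp => _ [u [u0 nNu] <-]; rewrite lee_fin leNgt.
  apply/negP => us; have := mono _ _ u0 (ltW us).
  by rewrite Nst => /(leq_trans nNu); rewrite ltnNge Ntn.
by move=> /le_trans/(_ tn_t); rewrite lee_fin leNgt ts.
Unshelve. all: by end_near. Qed.

Lemma counting_time_gt n t w : 0 <= t ->
  (t%:E < counting_time N n w)%E = (N t w <= n)%N.
Proof. by move=> t0; rewrite ltNge counting_time_le// -leqNgt. Qed.

Lemma counting_time_fin n t w : 0 <= t -> (n < N t w)%N ->
  exists2 r : R, counting_time N n w = r%:E & 0 <= r <= t.
Proof.
move=> t0; rewrite -counting_time_le//; have := counting_time_ge0 n w.
case: (counting_time N n w) => // r; rewrite !lee_fin => r0 rt.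
by exists r => //; rewrite r0.
Qed.

Lemma counting_time_nd n m w : (n <= m)%N ->
  (counting_time N n w <= counting_time N m w)%E.
Proof.
move=> nm; apply: le_ereal_inf_tmp => _ [t [t0 mNt] <-].
by rewrite counting_time_le//; exact: leq_ltn_trans mNt.
Qed.

(* Two consecutive counting times differ because [N] jumps by at most 1. *)
Lemma counting_time_ltS n w : (counting_time N n w < +oo)%E ->
  (counting_time N n w < counting_time N n.+1 w)%E.
Proof.
have [mono _ lcvg jump] := hN w.
have := counting_time_ge0 n w.
case tnE : (counting_time N n w) => [t||]//; rewrite lee_fin => t0 _.
rewrite counting_time_gt//; have := jump _ t0.
(* At time 0 the convention N(0-) = 0 allows at most one count; at [t > 0] every nearby
   [s < t = t_n] has [N s w <= n], which bounds the left limit. *)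
have [t_le0|t_gt0] := leP t 0.
  by rewrite /left_value t_le0 subr0 -[1]/(1%:R) ler_nat => /leq_trans; exact.
rewrite /left_value (leNgt t) t_gt0 /= lerBlDr => /le_trans Nt.
rewrite -(ler_nat R) -natr1 addrC; apply: Nt; rewrite lerD2l.
apply: limr_le; first exact: lcvg.
near=> s; rewrite ler_nat -counting_time_gt ?tnE ?lte_fin.
  by near: s; exact: nbhs_left_lt.
by near: s; exact: nbhs_left_ge.
Unshelve. all: by end_near. Qed.

Lemma trunc_interarrival_ge0 v n w : 0 < v -> 0 <= trunc_interarrival N v n w.
Proof.
move=> v0; rewrite /trunc_interarrival /interarrival.
have := counting_time_nd w (leq_pred n); have := counting_time_ge0 n w.
have := counting_time_ge0 n.-1 w.
case: (counting_time N n.-1 w) => [r||]//; case: (counting_time N n w) => [s||]//=.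
- rewrite !lee_fin => _ _ rs; rewrite -EFinB -EFin_min /=.
  by rewrite le_min subr_ge0 rs ltW.
- by move=> *; exact: ltW.
(* Both times are infinite: their difference is [-oo], which [fine] sends to 0. *)
- by rewrite min_l ?leNye.
Qed.

Hypothesis hN0 : forall w, N 0 w = 1%N.

Lemma counting_time0 w : counting_time N 0 w = 0%E.
Proof.
by apply/eqP; rewrite eq_le counting_time_ge0 andbT counting_time_le// hN0.
Qed.

Lemma counting_gt0 t w : 0 <= t -> (0 < N t w)%N.
Proof. by move=> t0; rewrite -counting_time_le// counting_time0. Qed.

(** Telescoping from t_0 = 0. Only t_{n-1} must be finite, so the residual time comes out as [+oo]
    after a last counting time. *)
Lemma sum_interarrival n w : (counting_time N n.-1 w < +oo)%E ->
  (\sum_(1 <= l < n.+1) interarrival N l w = counting_time N n w)%E.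
Proof.
elim: n => [|n IHn] tn; first by rewrite big_geq// counting_time0.
rewrite big_nat_recr//= IHn; last first.
  by apply: le_lt_trans tn => /=; exact: counting_time_nd (leq_pred n).
move: tn => /=; have := counting_time_ge0 n w; rewrite /interarrival /=.
case: (counting_time N n w) => // r _ _.
by rewrite addeC subeK.
Qed.

Lemma residualE t w : 0 <= t ->
  (residual N t w = counting_time N (N t w) w - t%:E)%E.
Proof.
move=> t0; rewrite /residual sum_interarrival//.
have /prednK NtK := counting_gt0 w t0.
have [|r -> _] := @counting_time_fin (N t w).-1 t w t0; last by rewrite ltey.
by rewrite NtK.
Qed.

Lemma counting_eq k t w : 0 <= t -> (0 < k)%N ->
  (N t w == k) = (counting_time N k.-1 w <= t%:E < counting_time N k w)%E.
Proof.
by move=> t0 /prednK kE; rewrite counting_time_le// counting_time_gt// kE eqn_leq andbC.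
Qed.

(** The part of [t_{k-1}, t_k) up to time [t] where the indicator in the integral is 1; the
    intensity is constant on it. *)
Definition small_residual v t k w : set R :=
  [set s | [/\ 0 <= s, s <= t, N s w = k & (residual N s w <= v%:E)%E]].

Lemma small_residual_out v t k w : 0 <= t -> ~~ (0 < k <= N t w)%N ->
  small_residual v t k w = set0.
Proof.
move=> t0 kN; rewrite -subset0 => s [s0 st sk _]; have [mono _ _ _] := hN w.
by move: kN; rewrite -sk counting_gt0//= mono.
Qed.

(** On [t_{k-1}, t_k) the bound R(s) <= v means s >= t_k - v, and t_k <= t, so nothing is cut off at
    [t]. *)
Lemma small_residual_past v t k w : 0 <= t -> (0 < k < N t w)%N ->
  small_residual v t k w =
  `[Num.max (fine (counting_time N k.-1 w)) (fine (counting_time N k w) - v),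
     fine (counting_time N k w)[%classic.
Proof.
move=> t0 /andP[k0 kN].
have [a aE /andP[a0 at_]] := counting_time_fin t0 (leq_ltn_trans (leq_pred k) kN).
have [b bE /andP[b0 bt]] := counting_time_fin t0 kN.
rewrite aE bE /=; apply/seteqP; split => s /=; rewrite in_itv/= ge_max lerBlDl.
  move=> [s0 st /eqP sk]; have := sk; rewrite counting_eq// aE bE lee_fin lte_fin.
  by move=> /andP[-> ->]; rewrite residualE// (eqP sk) bE -EFinB lee_fin lerBlDr andbT.
move=> /andP[/andP[as_ bs] sb]; have s0 : 0 <= s := le_trans a0 as_.
have sk : N s w == k by rewrite counting_eq// aE bE lee_fin lte_fin as_.
split => //; [by rewrite (le_trans (ltW sb))|exact/eqP|].
by rewrite residualE// (eqP sk) bE -EFinB lee_fin lerBlDr.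
Qed.

(** Now t_k > t and the interval is cut at [t]; if t_k is [+oo], so is the residual time, and no
    point qualifies. *)
Lemma small_residual_last v t w : 0 <= t ->
  small_residual v t (N t w) w =
  if counting_time N (N t w) w is b%:E
  then `[Num.max (fine (counting_time N (N t w).-1 w)) (b - v), t]%classic
  else set0.
Proof.
move=> t0; have Nt0 := counting_gt0 w t0; have NtK := prednK Nt0.
have [|a aE /andP[a0 at_]] := @counting_time_fin (N t w).-1 t w t0; first by rewrite NtK.
have := counting_time_gt (N t w) w t0; rewrite leqnn.
have := counting_time_ge0 (N t w) w.
case bE : (counting_time N (N t w) w) => [b||]// _; last first.
  move=> _; rewrite -subset0 => s [s0 st sk].
  by rewrite residualE// sk bE.
rewrite lte_fin aE /= => tb.
apply/seteqP; split => s /=; rewrite in_itv/= ge_max lerBlDl.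
  move=> [s0 st /eqP sk]; have := sk; rewrite counting_eq// aE bE lee_fin.
  by move=> /andP[-> _]; rewrite residualE// (eqP sk) bE -EFinB lee_fin lerBlDr st andbT.
move=> /andP[/andP[as_ bs] st]; have s0 : 0 <= s := le_trans a0 as_.
have sk : N s w == N t w.
  by rewrite counting_eq// aE bE lee_fin lte_fin as_ (le_lt_trans st tb).
split => //; first exact/eqP.
by rewrite residualE// (eqP sk) bE -EFinB lee_fin lerBlDr.
Qed.

Lemma measurable_small_residual v t k w : 0 <= t ->
  measurable (small_residual v t k w).
Proof.
move=> t0; have [/andP[k0]|kN] := boolP (0 < k <= N t w)%N; last first.
  by rewrite small_residual_out.
rewrite leq_eqVlt => /predU1P[->|kN].
  by rewrite small_residual_last//; case: (counting_time _ _ _).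
by rewrite small_residual_past// k0.
Qed.

(** In the current interval the missing length beyond [t] is R^(v)(t), also when R(t) > v and the
    whole part lies after [t]. If t_k is [+oo], both truncations equal [v] and cancel. *)
Lemma lebesgue_small_residual v t k w : 0 < v -> 0 <= t -> (0 < k <= N t w)%N ->
  lebesgue_measure (small_residual v t k w) =
  (trunc_interarrival N v k w
     - (k == N t w)%:R * trunc_residual N v t w)%:E.
Proof.
move=> v0 t0 /andP[k0 kNt].
rewrite /trunc_interarrival /trunc_residual /interarrival residualE//.
have [a aE /andP[a0 at_]] : exists2 a : R, counting_time N k.-1 w = a%:E & 0 <= a <= t.
  by apply: counting_time_fin => //; rewrite prednK.
have [kE|kN] := eqVneq k (N t w); last first.
  rewrite mul0r subr0.
  have {}kN : (k < N t w)%N by rewrite ltn_neqAle kN.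
  have [b bE /andP[b0 bt]] := counting_time_fin t0 kN.
  have := @counting_time_ltS k.-1 w; rewrite prednK// aE bE ltry lte_fin => /(_ isT) ab.
  rewrite small_residual_past ?k0// lebesgue_measure_itv /= aE bE /= lte_fin gt_max ab.
  rewrite ltrBlDr ltrDl v0 -!EFinB -EFin_min /=; congr (_%:E).
  by rewrite maxEle minEle; case: leP => ?; case: leP => ?; lra.
subst k; rewrite mul1r small_residual_last// aE.
have := counting_time_gt (N t w) w t0; rewrite leqnn.
have := counting_time_ge0 (N t w) w.
case: (counting_time N (N t w) w) => [b||]//= _; last by rewrite measure0 subrr.
rewrite lte_fin => tb.
rewrite lebesgue_measure_itv /= lte_fin -!EFinB -!EFin_min /=.
rewrite maxEle !minEle; case: (leP a) => ?; case: (leP (b - a)) => ?;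
  case: (leP (b - t)) => ?; case: ltP => ?; congr (_%:E); lra.
Qed.

Variables (C : nat -> T -> R) (lam : R -> T -> R).
Hypothesis hlam : reciprocal_intensity N C lam.

Lemma intensityE t w : 0 <= t -> lam t w = 1 / C (N t w) w.
Proof.
move=> t0; have := counting_eq w t0 (counting_gt0 w t0).
by rewrite eqxx => /esym/andP[? ?]; apply: hlam => //; exact: counting_gt0.
Qed.

(** Finite counting times increase strictly, so t_{k-1} lies in its own interval [t_{k-1}, t_k). *)
Lemma intensity_counting_time k t w : 0 <= t -> (0 < k <= N t w)%N ->
  lam (fine (counting_time N k.-1 w)) w = 1 / C k w.
Proof.
move=> t0 /andP[k0 kN].
have [|a aE _] := @counting_time_fin k.-1 t w t0; first by rewrite prednK.
apply: hlam => //; rewrite aE//= -aE.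
by have := @counting_time_ltS k.-1 w; rewrite prednK//; apply; rewrite aE ltry.
Qed.

Lemma counting_martingaleE v t w : 0 <= t ->
  counting_martingale N v lam t w =
  \sum_(1 <= n < (N t w).+1) (1 - trunc_interarrival N v n w / C n w).
Proof.
move=> t0; apply: eq_big_nat => n /andP[n0 nN].
by rewrite (@intensity_counting_time n t)// ?n0// div1r mulrC.
Qed.

Lemma integral_intensity v t w : 0 < v -> 0 <= t ->
  \int[lebesgue_measure]_(s in `[0, t])
     (lam s w * ((residual N s w <= v%:E)%E)%:R) =
  \sum_(1 <= n < (N t w).+1) trunc_interarrival N v n w / C n w
    - trunc_residual N v t w / C (N t w) w.
Proof.
move=> v0 t0; pose J k := small_residual v t k w.
have mJ k : measurable (J k) := measurable_small_residual v k w t0.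
have JD k : J k `&` `[0, t] = J k.
  by apply/setIidl => s [s0 st _ _]; rewrite /= in_itv/= s0.
have iJ k : lebesgue_measure.-integrable `[0, t] (fun s => (\1_(J k) s)%:E).
  apply/integrableP; split.
    apply/measurable_EFinP; apply: measurable_indic. exact: mJ.
  under eq_integral do rewrite gee0_abs ?lee_fin//.
  rewrite integral_indic//; last exact: mJ.
  rewrite JD; have [kN|kN] := boolP (0 < k <= N t w)%N.
    by rewrite [ltLHS](lebesgue_small_residual v0 t0 kN) ltry.
  by rewrite /J small_residual_out// measure0.
rewrite /Rintegral.
under eq_integral => s.
  rewrite inE /= in_itv /= => /andP[s0 st].
  (* Only the index [N s w] can contribute at [s], which turns the integrand into a finite
     combination of indicators. *)
  have -> : (lam s w * ((residual N s w <= v%:E)%E)%:R)%:E =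
    (\sum_(1 <= k < (N t w).+1) ((C k w)^-1)%:E * (\1_(J k) s)%:E)%E.
    have NsNt : (N s w <= N t w)%N by have [mono _ _ _] := hN w; exact: mono.
    rewrite (bigD1_seq (N s w)) ?iota_uniq ?mem_index_iota ?counting_gt0//= ?ltnS ?NsNt//=.
    rewrite big1 => [|k sk].
      rewrite adde0 intensityE// div1r -EFinM; congr ((_ * _)%:E).
      rewrite indicE; congr (nat_of_bool _)%:R.
      by apply/idP/idP => [sv|]; rewrite inE; [split|case].
    rewrite indicE memNset ?mule0//= => -[_ _ Ns _].
    by rewrite Ns eqxx in sk.
  over.
rewrite integral_sum//; last by move=> k; exact: integrableZl.
under eq_big_nat => k /andP[k0 kN].
  rewrite integralZl// integral_indic//; last exact: mJ.
  rewrite JD [X in (_ * X)%E](lebesgue_small_residual v0 t0 (introT andP (conj k0 kN))).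
  rewrite -EFinM mulrBr mulrC.
  over.
rewrite sumEFin /= sumrB; congr (_ - _).
(* The correction for the unfinished interval occurs only at [k = N t w]. *)
rewrite (bigD1_seq (N t w)) ?iota_uniq ?mem_index_iota ?counting_gt0//= ?ltnS ?NsNt//=.
rewrite eqxx mul1r mulrC big1 ?addr0// => k /negbTE ->.
by rewrite mul0r mulr0.
Qed.

(** The sums of T_n^(v)/C_n cancel, as do the terms in R^(v)(t), which leaves a sum of N(t) ones. *)
Lemma counting_decomposition v t w : 0 < v -> 0 <= t ->
  (N t w)%:R
  = \int[lebesgue_measure]_(s in `[0, t])
      (lam s w * ((residual N s w <= v%:E)%E)%:R)
    + lam t w * trunc_residual N v t w
    + counting_martingale N v lam t w.
Proof.
move=> v0 t0; rewrite integral_intensity// intensityE// counting_martingaleE//.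
rewrite sumrB sumr_const_nat subn1 div1r mulrC; ring.
Qed.

End Paths.

(** * Measurability of the reciprocal *)

Section Measurability.
Context {d : measure_display} {T : measurableType d} {R : realType}.

Lemma measurable_funV (D : set T) (f : T -> R) :
  measurable_fun D f -> measurable_fun D (fun w => (f w)^-1).
Proof.
move=> mf.
(* The identity 1/x = x (1/|x|)^2 also holds at 0, where the inverse is 0, and 1/|x| is a power of a
   nonnegative number. *)
suff -> : (fun w => (f w)^-1) = (fun w => f w * (`|f w| `^ (-1)) ^+ 2).
  apply: measurable_funM => //; apply: measurable_funX.
  apply: (measurableT_comp (measurable_powR (-1))).
  exact: measurableT_comp.
apply/funext => w; rewrite powR_inv1// exprVn real_normK ?num_real//.
by have [->|fw0] := eqVneq (f w) 0; [rewrite invr0 mul0r|field].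
Qed.

End Measurability.

(** * Integrals of g(Y) Z through simple functions of Y *)

Section NnsfunComposition.
Local Open Scope ereal_scope.
Context {d : measure_display} {T : measurableType d} {R : realType}.
Variables (mu : {measure set T -> \bar R}) (Y : T -> R).
Hypothesis mY : measurable_fun setT Y.
Import HBNNSimple.

(** Reduces to integrals of [Z] over level sets of [h \o Y], the form to which the defining property
    of a conditional expectation applies. *)
Lemma integral_nnsfun_comp (A : set T) (Z : T -> R) (h : {nnsfun R >-> R}) :
  measurable A -> measurable_fun setT Z -> (forall w, A w -> (0 <= Z w)%R) ->
  \int[mu]_(w in A) (h (Y w) * Z w)%:E =
  \sum_(r \in range h)
    r%:E * \int[mu]_(w in A `&` Y @^-1` (h @^-1` [set r])) (Z w)%:E.
Proof.
move=> mA mZ Z0.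
have mYh r : measurable (Y @^-1` (h @^-1` [set r])).
  by rewrite -[_ @^-1` _]setTI; exact: mY.
under eq_integral => w wA.
  rewrite fimfunE EFinM -fsumEFin// ge0_mule_fsuml; last first.
    by move=> r; rewrite EFinM nnfun_muleindic_ge0.
  over.
rewrite ge0_integral_fsum//; last 2 first.
- move=> r; apply: emeasurable_funM; last first.
    exact/measurable_EFinP/measurable_funTS.
  apply/measurable_EFinP/measurable_funTS/measurable_funM => //.
  exact: (measurableT_comp _ mY).
- move=> r w Aw; rewrite mule_ge0 ?lee_fin ?Z0// -lee_fin.
  by rewrite EFinM nnfun_muleindic_ge0.
apply: eq_fsbigr => r; rewrite inE => -[y _ <-].
rewrite integral_mkcondr -ge0_integralZl//.
- apply: eq_integral => w wA; rewrite patchE.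
  have [/set_mem wh|/negP wh] := boolP (w \in _).
    by rewrite indicE mem_set//= mulr1.
  rewrite indicE memNset; first by rewrite mulr0 mul0e mule0.
  by move=> hw; apply: wh; rewrite inE.
- apply/(measurable_restrict _ (mYh _) mA); exact/measurable_EFinP/measurable_funTS.
- by move=> w Aw; rewrite patchE; case: ifP => // _; rewrite lee_fin Z0.
- by rewrite lee_fin.
Qed.

Lemma cvg_integral_nnsfun_approx_comp (A : set T) (Z : T -> R) (g : R -> R)
    (mg : measurable_fun setT (EFin \o g)) :
  measurable A -> measurable_fun setT Z -> (forall w, A w -> (0 <= Z w)%R) ->
  (forall y, (0 <= g y)%R) ->
  \int[mu]_(w in A) (nnsfun_approx measurableT mg n (Y w) * Z w)%:E @[n --> \oo]
    --> \int[mu]_(w in A) (g (Y w) * Z w)%:E.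
Proof.
move=> mA mZ Z0 g0.
have -> : \int[mu]_(w in A) (g (Y w) * Z w)%:E =
  \int[mu]_(w in A) limn (fun n => (nnsfun_approx measurableT mg n (Y w) * Z w)%:E).
  apply: eq_integral => w wA; apply/esym/cvg_lim => //.
  under eq_fun do rewrite EFinM; rewrite EFinM; apply: cvgeZr => //.
  by apply: cvg_nnsfun_approx => //= y _; rewrite lee_fin.
apply: cvg_monotone_convergence => //.
- move=> n; apply/measurable_EFinP/measurable_funTS/measurable_funM => //.
  exact: measurableT_comp.
- by move=> n w Aw; rewrite lee_fin mulr_ge0 ?Z0.
- move=> w Aw m n mn; rewrite lee_fin ler_wpM2r ?Z0//.
  by have /lefP := nd_nnsfun_approx measurableT mg mn; exact.
Qed.

End NnsfunComposition.

(** * Dividing a positive variable by its conditional expectation *)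

Section CondExpectation.
Local Open Scope ereal_scope.
Context {d : measure_display} {T : measurableType d} {R : realType}.
Variables (P : probability T R) (G : set (set T)) (X Y : T -> R).
Import HBNNSimple.
Hypotheses (sG : sigma_algebra setT G) (mG : G `<=` measurable).
Hypothesis XY : cond_expectation P G X Y.
Hypotheses (mX : measurable_fun setT X) (X0 : forall w, (0 <= X w)%R).

Let mY : measurable_fun setT Y.
Proof. by move=> _ B mB; rewrite setTI; apply: mG; have [+ _ _] := XY; exact. Qed.

Let GI A B : G A -> G B -> G (A `&` B).
Proof. by rewrite -(measurable_g_measurableTypeE sG); exact: measurableI. Qed.

(* Taking out what is known: neither side needs to be finite. *)
Lemma cond_expectation_mul (A : set T) (g : R -> R) : G A ->
  (forall w, A w -> (0 <= Y w)%R) -> measurable_fun setT g ->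
  (forall y, (0 <= g y)%R) ->
  \int[P]_(w in A) (g (Y w) * X w)%:E = \int[P]_(w in A) (g (Y w) * Y w)%:E.
Proof.
move=> GA Y0 mg g0; have mA := mG GA.
have mg' : measurable_fun setT (EFin \o g) by exact/measurable_EFinP.
have cX := cvg_integral_nnsfun_approx_comp (mu := P) mY mg' mA mX (fun w _ => X0 w) g0.
have cY := cvg_integral_nnsfun_approx_comp (mu := P) mY mg' mA mY Y0 g0.
suff cYX : (fun n => \int[P]_(w in A) (nnsfun_approx measurableT mg' n (Y w) * Y w)%:E) =
  (fun n => \int[P]_(w in A) (nnsfun_approx measurableT mg' n (Y w) * X w)%:E).
  by apply: cvg_unique cX _; rewrite // -cYX.
apply/funext => n; rewrite !(integral_nnsfun_comp _ mY)//.
(* The level sets of [h \o Y] belong to [G], so [X] and [Y] have equal integrals over their traces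
   on [A]. *)
apply: eq_fsbigr => r _; congr (_ * _).
have [mGY _ ->//] := XY.
by apply: GI => //; exact: mGY.
Qed.

Hypothesis Xpos : {ae P, forall w, (0 < X w)%R}.

(** Over {Y <= 0}, a set of [G], the integral of X >= 0 equals that of Y and is at most 0, so X
    vanishes almost everywhere there; as X > 0 almost surely, the set is null. *)
Lemma cond_expectation_gt0 : {ae P, forall w, (0 < Y w)%R}.
Proof.
have [mGY iY eY] := XY.
pose A := Y @^-1` `]-oo, 0%R].
have GA : G A by apply: mGY.
have mA := mG GA.
have X_eq0 : \int[P]_(w in A) `|(X w)%:E| = 0.
  under eq_integral do rewrite gee0_abs ?lee_fin//.
  apply/eqP; rewrite eq_le integral_ge0 ?andbT//; last by move=> w _; rewrite lee_fin.
  rewrite -eY//; rewrite -[leRHS](integral0 P A).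
  apply: le_integral => //; first exact: integrableS iY.
    exact: integrable0.
  by move=> w /set_mem; rewrite /A /= in_itv /= lee_fin.
have : ae_eq P A (EFin \o X) (cst 0).
  by apply/ae_eq_integral_abs => //; exact/measurable_EFinP/measurable_funTS.
move: Xpos; apply: filterS2 => w Xw XA; rewrite ltNge; apply/negP => Yw.
have [] : (X w)%:E = 0 by apply: XA; rewrite /A /= in_itv.
by move=> Xw0; rewrite Xw0 ltxx in Xw.
Qed.

(** Taking out g(y) = 1/|y| on A /\ {Y > 0} replaces X/Y by Y/Y = 1, and the rest of [A] is null.
    This also yields the integrability of X/Y. *)
Lemma integral_div_cond_expectation (A : set T) : G A ->
  \int[P]_(w in A) `|X w / Y w|%:E = P A.
Proof.
move=> GA; have [mGY iY _] := XY.
pose A' := A `&` Y @^-1` `]0%R, +oo[.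
have GA' : G A' by apply: GI => //; exact: mGY.
have [mA mA'] := (mG GA, mG GA').
have mV : measurable_fun setT (fun y : R => `|y|^-1)%R.
  by apply: measurable_funV; exact: normr_measurable.
have PAA' (f : T -> R) : measurable_fun setT f -> (forall w, 0 <= f w)%R ->
  \int[P]_(w in A) (f w)%:E = \int[P]_(w in A') (f w)%:E.
  move=> mf f0; rewrite /A' integral_mkcondr.
  apply: ge0_ae_eq_integral => //.
  - exact/measurable_EFinP/measurable_funTS.
  - apply/(measurable_restrict _ _ mA).
      by rewrite -[_ @^-1` _]setTI; exact: mY.
    exact/measurable_EFinP/measurable_funTS.
  - by move=> w _; rewrite lee_fin.
  - by move=> w _; rewrite patchE; case: ifP; rewrite ?lee_fin.
  - move: cond_expectation_gt0; apply: filterS => w Yw _.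
    by rewrite patchE mem_set//= in_itv/= Yw.
rewrite PAA'//; last first.
  apply: measurableT_comp => //; apply: measurable_funM => //.
  exact: measurable_funV.
have -> : \int[P]_(w in A') `|X w / Y w|%:E = \int[P]_(w in A') (`|Y w|^-1 * X w)%:E.
  by apply: eq_integral => w _; rewrite normrM normfV ger0_norm// mulrC.
rewrite (cond_expectation_mul GA' _ mV)//; last first.
  by move=> w [_] /=; rewrite in_itv/= andbT => /ltW.
transitivity (\int[P]_(w in A') (1%R)%:E).
  apply: eq_integral => w; rewrite inE => -[_] /=; rewrite in_itv/= andbT => Yw.
  by rewrite gtr0_norm// mulVf// gt_eqF.
rewrite -(PAA' (fun=> 1%R))//.
by rewrite integral_cst// mul1e.
Qed.

Let mXY : measurable_fun setT (fun w => X w / Y w)%R.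
Proof. by apply: measurable_funM => //; exact: measurable_funV. Qed.

Let integrable_XY A : G A -> P.-integrable A (fun w => (X w / Y w)%:E).
Proof.
move=> GA; apply/integrableP; split.
  exact/measurable_EFinP/measurable_funTS.
rewrite integral_div_cond_expectation//.
by rewrite (le_lt_trans (probability_le1 _ _)) ?ltry//; exact: mG.
Qed.

Lemma integral_onem_div_cond_expectation (A : set T) : G A ->
  \int[P]_(w in A) (1 - X w / Y w)%:E = 0.
Proof.
move=> GA; have mA := mG GA.
under eq_integral do rewrite EFinB.
rewrite integralB//; [|exact: finite_measure_integrable_cst|exact: integrable_XY].
rewrite integral_cst// mul1e.
rewrite (_ : \int[P]_(w in A) (X w / Y w)%:E = P A); last first.
  rewrite -(integral_div_cond_expectation GA).
  apply: ae_eq_integral => //.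
  - exact/measurable_EFinP/measurable_funTS.
  - apply/measurable_EFinP/measurable_funTS; exact: measurableT_comp.
  - move: cond_expectation_gt0; apply: filterS => w Yw _ /=.
    by rewrite ger0_norm// divr_ge0// ltW.
by rewrite subee// fin_num_measure.
Qed.

(** The triangle inequality: 1 and |X/Y| each contribute [P A]. *)
Lemma integral_norm_onem_div_cond_expectation (A : set T) : G A ->
  \int[P]_(w in A) `|1 - X w / Y w|%:E <= 2%:E * P A.
Proof.
move=> GA; have mA := mG GA.
have mN : measurable_fun A (fun w => `|X w / Y w|%:E).
  by apply/measurable_EFinP/measurable_funTS; exact: measurableT_comp.
apply: (@le_trans _ _ (\int[P]_(w in A) (1 + `|X w / Y w|%:E))).
  apply: ge0_le_integral => //.
  - apply/measurable_EFinP/measurable_funTS/measurableT_comp => //.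
    exact: measurable_funB.
  - exact: emeasurable_funD.
  - by move=> w _; rewrite -EFinD lee_fin (le_trans (ler_normB _ _))// normr1.
rewrite ge0_integralD// integral_cst// mul1e integral_div_cond_expectation//.
by rewrite mule_natl mule2n.
Qed.

End CondExpectation.

(** * Sums with a random number of terms *)

Section RandomSum.
Context {d : measure_display} {T : measurableType d} {R : realType}.
Variables (K : T -> nat) (D : nat -> T -> R).
Hypothesis mK : forall n, measurable [set w | (n < K w)%N].

(** Deterministic truncations of the random sum; for fixed [w] they are constant from [m = K w]
    on. *)
Let ps m w : R := \sum_(0 <= n < m) if (n < K w)%N then D n w else 0.

Let ps_stable m w : (K w <= m)%N -> ps m w = \sum_(0 <= n < K w) D n w.
Proof.
move=> Km; rewrite /ps (big_cat_nat _ Km)//= [X in _ + X]big1_seq ?addr0.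
  by apply: eq_big_nat => n /andP[_ ->].
by move=> n /=; rewrite mem_index_iota => /andP[Kn _]; rewrite ltnNge Kn.
Qed.

Let cvg_ps w : ps ^~ w @ \oo --> \sum_(0 <= n < K w) D n w.
Proof.
apply: cvg_near_cst; exists (K w) => // m /=; exact: ps_stable.
Qed.

Let measurable_ps m : (forall n, measurable_fun [set w | (n < K w)%N] (D n)) ->
  measurable_fun setT (ps m).
Proof.
move=> mD; apply: measurable_sum => n; apply: measurable_fun_if => //.
- by apply: (measurable_fun_bool true); rewrite setTI preimage_true; exact: mK.
- by rewrite setTI preimage_true; exact: mD.
Qed.

(** Measurability of [D n] is asked only on {n < K}, because at time t the variable T_{n+1}^(v) is
    known only once t_n <= t. *)
Lemma measurable_random_sum :
  (forall n, measurable_fun [set w | (n < K w)%N] (D n)) ->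
  measurable_fun setT (fun w => \sum_(0 <= n < K w) D n w).
Proof.
move=> mD; apply: (measurable_fun_cvg (h := ps)) => [m|w _]; first exact: measurable_ps.
exact: cvg_ps.
Qed.

Local Open Scope ereal_scope.

(* Dominated convergence, with dominating function [\sum_(n < K) |D n|], whose
   integral is at most [c] times that of [K]. *)
Lemma integral_random_sum (mu : {measure set T -> \bar R}) (c : R) :
  (forall n, measurable_fun setT (D n)) ->
  (forall n, \int[mu]_(w in [set w | (n < K w)%N]) `|D n w|%:E <=
             c%:E * mu [set w | (n < K w)%N]) ->
  \int[mu]_w (K w)%:R%:E < +oo ->
  mu.-integrable setT (EFin \o (fun w => \sum_(0 <= n < K w) D n w)%R) /\
  forall A, measurable A ->
    \sum_(0 <= n < m) \int[mu]_(w in A `&` [set w | (n < K w)%N]) (D n w)%:E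
      @[m --> \oo] --> \int[mu]_(w in A) (\sum_(0 <= n < K w) D n w)%R%:E.
Proof.
move=> mD D_le K_fin.
have E_int n (A : set T) (f : T -> R) : measurable A ->
    \int[mu]_(w in A) (if (n < K w)%N then f w else 0%R)%:E =
    \int[mu]_(w in A `&` [set w | (n < K w)%N]) (f w)%:E.
  move=> mA; rewrite integral_mkcondr; apply: eq_integral => w wA.
  rewrite patchE; have [nK|nK] := boolP (n < K w)%N.
    by rewrite mem_set.
  by rewrite memNset//; exact/negP.
have mif n (f : T -> R) : measurable_fun setT f ->
    measurable_fun setT (fun w => if (n < K w)%N then f w else 0%R).
  move=> mf; apply: measurable_fun_if => //.
  - by apply: (measurable_fun_bool true); rewrite setTI preimage_true; exact: mK.
  - exact: measurable_funTS.
(* The tail-sum formula: for fixed [w] the indicators of [n < K w] add up to [K w]. *)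
have sum_muE : \sum_(n <oo) mu [set w | (n < K w)%N] = \int[mu]_w (K w)%:R%:E.
  transitivity (\sum_(n <oo) \int[mu]_w (if (n < K w)%N then 1%R else 0%R)%:E).
    apply: eq_eseriesr => n _; rewrite E_int// setTI integral_cst ?mul1e//.
  rewrite -integral_nneseries//; last 2 first.
  - by move=> n; apply/measurable_EFinP; exact: mif.
  - by move=> n w _; case: ifP.
  apply: eq_integral => w _; rewrite (nneseries_split 0 (K w)); last first.
    by move=> n _; case: ifP.
  rewrite add0n eseries0 ?adde0; last by move=> n Kn _; rewrite ltnNge Kn.
  rewrite sumEFin; congr EFin.
  under eq_big_nat => n /andP[_ ->] do [].
  by rewrite sumr_const_nat subn0.
pose g w := \sum_(n <oo) (if (n < K w)%N then `|D n w|%R else 0%R)%:E.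
have g_n0 n w : 0 <= (if (n < K w)%N then `|D n w|%R else 0%R)%:E.
  by case: ifP => _; rewrite lee_fin.
have mg_n n : measurable_fun setT (fun w => (if (n < K w)%N then `|D n w|%R else 0%R)%:E).
  by apply/measurable_EFinP; apply: mif; exact: measurableT_comp.
have ig : mu.-integrable setT g.
  apply/integrableP; split.
    by apply: ge0_emeasurable_sum => // n w _ _; exact: g_n0.
  under eq_integral do rewrite gee0_abs ?nneseries_ge0//.
  rewrite integral_nneseries//.
  apply: (@le_lt_trans _ _ (c%:E * \int[mu]_w (K w)%:R%:E)).
    rewrite -sum_muE -nneseriesZl//; apply: lee_nneseries => n _.
      by move=> _; apply: integral_ge0.
    by rewrite E_int// setTI.
  rewrite -(@fineK _ (\int[mu]_w _)) ?ltry// ge0_fin_numE//.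
  by apply: integral_ge0 => w _; rewrite lee_fin.
have ps_g m w : `|(ps m w)%:E| <= g w.
  apply: (@le_trans _ _ (\sum_(0 <= n < m) (if (n < K w)%N then `|D n w|%R else 0%R)%:E)).
    rewrite sumEFin lee_fin (le_trans (ler_norm_sum _ _ _))//.
    by apply: ler_sum => n _; case: ifP; rewrite ?normr0.
  by apply: nneseries_lim_ge.
have mps m : measurable_fun setT (ps m).
  by apply: measurable_ps => n; exact: measurable_funTS.
have mS : measurable_fun setT (fun w => \sum_(0 <= n < K w) D n w)%R.
  by apply: measurable_random_sum => n; exact: measurable_funTS.
have DC A (mA : measurable A) := @dominated_convergence _ _ _ mu A mA
  (fun m w => (ps m w)%:E) (fun w => (\sum_(0 <= n < K w) D n w)%R%:E) g.
have {}DC A : measurable A ->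
    mu.-integrable A (fun w => (\sum_(0 <= n < K w) D n w)%R%:E) /\
    \int[mu]_(w in A) (ps m w)%:E @[m --> \oo] -->
      \int[mu]_(w in A) (\sum_(0 <= n < K w) D n w)%R%:E.
  move=> mA; have [||||//|iS _ cS] := DC A mA; last by split.
  - by move=> m; apply/measurable_EFinP; exact: measurable_funTS.
  - by apply/measurable_EFinP; exact: measurable_funTS.
  - by apply: aeW => w _; apply: cvg_EFin; [exact: nearW|exact: cvg_ps].
  - exact: integrableS ig.
  - by apply: aeW => w m _; exact: ps_g.
split; first by have [] := DC _ measurableT.
move=> A mA; have [_] := DC _ mA.
suff -> : (fun m => \int[mu]_(w in A) (ps m w)%:E) =
  (fun m => \sum_(0 <= n < m) \int[mu]_(w in A `&` [set w | (n < K w)%N]) (D n w)%:E) by [].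
apply/funext => m; under eq_integral do rewrite -sumEFin.
rewrite integral_sum//; last first.
  move=> n; apply: (@integrableS _ _ _ mu setT) => //.
  apply: le_integrable ig => //.
    by apply/measurable_EFinP; exact: mif.
  move=> w _; rewrite [leRHS]gee0_abs ?nneseries_ge0//.
  (* A single term is below the partial sum of [g] that ends with it, hence integrable. *)
  apply: le_trans (nneseries_lim_ge n.+1 _) => //.
  rewrite big_nat_recr//= (fun_if Num.norm) normr0 leeDr// sume_ge0//.
by apply: eq_bigr => n _; rewrite E_int.
Qed.

End RandomSum.

(** * Stopping times and their strict past *)

Section Filtrations.
Local Open Scope ereal_scope.
Context {d : measure_display} {T : measurableType d} {R : realType}.
Variables (F : R -> set (set T)).
Hypothesis hF : filtration F.
Implicit Types (tau : T -> \bar R) (t : R).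

Lemma filtration_measurableE t : (0 <= t)%R ->
  (measurable : set (set (g_sigma_algebraType (F t)))) = F t.
Proof. by have [sF _ _] := hF; move=> /sF/measurable_g_measurableTypeE. Qed.

Lemma measurable_fun_ereal_le {d'} {S : measurableType d'} (f : S -> \bar R) :
  (forall r : R, measurable [set w | f w <= r%:E]) -> measurable_fun setT f.
Proof.
move=> mf; apply: (measurability _ (ErealGenOInfty.measurableE R)) => //.
move=> _ [_ [r ->] <-]; rewrite setTI.
rewrite (_ : _ @^-1` _ = ~` [set w | f w <= r%:E]); first exact/measurableC/mf.
by apply/seteqP; split => w /=; rewrite in_itv/= andbT ltNge => /negP.
Qed.

(** Only levels [0 <= r < u] give a nontrivial event, namely {tau <= r}, which is in F_r and hence
    in F_t. *)
Lemma measurable_stopping_min tau t u : (0 <= t)%R ->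
  (forall s, (0 <= s)%R -> F s [set w | tau w <= s%:E]) ->
  (forall w, 0 <= tau w) -> (u <= t)%R ->
  measurable_fun (setT : set (g_sigma_algebraType (F t)))
    (fun w => Order.min (tau w) u%:E).
Proof.
move=> t0 stop tau0 ut; apply: measurable_fun_ereal_le => r.
have [ur|ru] := leP u r.
  rewrite (_ : [set w | _] = setT) //; apply/seteqP; split => // w _ /=.
  by rewrite ge_min lee_fin ur orbT.
have [r0|r0] := leP 0%R r.
  rewrite filtration_measurableE// (_ : [set w | _] = [set w | tau w <= r%:E]).
    have [_ _ mono] := hF; apply: (mono r) => //; last exact: stop.
    exact/ltW/(lt_le_trans ru).
  by apply/seteqP; split => w /=; rewrite ge_min lee_fin (leNgt u) ru orbF.
rewrite (_ : [set w | _] = set0) // -subset0 => w /=.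
rewrite ge_min lee_fin (leNgt u) ru orbF => /(le_trans (tau0 w)).
by rewrite lee_fin leNgt r0.
Qed.

Lemma sub_strict_past tau : (forall s, (0 <= s)%R -> F s [set w | tau w <= s%:E]) ->
  strict_past F tau `<=` measurable.
Proof.
move=> stop; have [_ mF _] := hF; apply: smallest_sub.
  split; [exact: measurable0| |exact: bigcupT_measurable].
  by move=> A mA; rewrite setTD; exact: measurableC.
move=> _ [t [A [t0 FA ->]]]; apply: measurableI; first exact: (mF t).
rewrite (_ : [set w | _] = ~` [set w | tau w <= t%:E]).
  by apply: measurableC; apply: (mF t) => //; exact: stop.
by apply/seteqP; split => w /=; rewrite ltNge => /negP.
Qed.

Lemma strict_past_gt tau t A : (0 <= t)%R -> F t A ->
  strict_past F tau (A `&` [set w | t%:E < tau w]).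
Proof. by move=> t0 FA; apply: sub_sigma_algebra; exists t, A. Qed.

(** The complement of the generator in which [A] is the whole space. *)
Lemma strict_past_le tau t : (0 <= t)%R ->
  strict_past F tau [set w | tau w <= t%:E].
Proof.
move=> t0.
have [_ sC _] := smallest_sigma_algebra setT
  [set B | exists t A, [/\ (0 <= t)%R, F t A & B = A `&` [set w | t%:E < tau w]]].
have FT : F t setT by rewrite -filtration_measurableE//; exact: measurableT.
have := sC _ (strict_past_gt (tau := tau) t0 FT); rewrite setTI setTD.
rewrite (_ : ~` _ = [set w | tau w <= t%:E])//.
by apply/seteqP; split => w /=; rewrite leNgt => /negP.
Qed.

(** The inclusion of F_{tau-} in F_tau, by induction on the generated sigma-algebra: a generator
    inside {s < tau} misses {tau <= t} when s > t, and for s <= t all sets involved are in F_t. *)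
Lemma strict_past_before tau t A : (0 <= t)%R ->
  (forall s, (0 <= s)%R -> F s [set w | tau w <= s%:E]) ->
  strict_past F tau A -> F t (A `&` [set w | tau w <= t%:E]).
Proof.
move=> t0 stop; have [_ _ mono] := hF.
have Ftau := stop t t0; rewrite -filtration_measurableE// in Ftau *.
move: A; apply: smallest_sub.
  split => /=; first by rewrite set0I; exact: measurable0.
  - move=> A mA; rewrite setTD.
    rewrite (_ : _ `&` _ = [set w | tau w <= t%:E] `\` (A `&` [set w | tau w <= t%:E])).
      exact: measurableD.
    apply/seteqP; split => w /= [].
      by move=> nA tw; split => // -[].
    by move=> tw nA; split => // Aw; apply: nA.
  - by move=> A mA; rewrite setI_bigcupl; exact: bigcupT_measurable.
move=> _ [s [A [s0 FA ->]]] /=; have [st|ts] := leP s t.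
  apply: measurableI => //; apply: measurableI.
    by rewrite filtration_measurableE//; exact: mono FA.
  rewrite (_ : [set w | _] = ~` [set w | tau w <= s%:E]).
    by apply: measurableC; rewrite filtration_measurableE//; apply: mono (stop s s0).
  by apply/seteqP; split => w /=; rewrite ltNge => /negP.
rewrite (_ : _ `&` _ = set0); first exact: measurable0.
rewrite -subset0 => w /= [[_ sw] wt]; have := lt_le_trans sw wt.
by rewrite lte_fin ltNge (ltW ts).
Qed.

End Filtrations.

(** * Adaptedness of the terms of the martingale *)

Section Adapted.
Local Open Scope ereal_scope.
Context {d : measure_display} {T : measurableType d} {R : realType}.
Variables (N : R -> T -> nat) (F : R -> set (set T)).
Hypotheses (hN : counting_process N) (hF : filtration F).
Hypothesis hX : forall t : R, (0 <= t)%R ->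
  natural_sigma_algebra (state N) t `<=` F t.
Hypothesis hN0 : forall w, N 0%R w = 1%N.
Implicit Types (t v : R) (n : nat).

Lemma measurable_state t : (0 <= t)%R ->
  measurable_fun (setT : set (g_sigma_algebraType (F t))) (state N t).
Proof.
move=> t0 _ B mB; rewrite setTI filtration_measurableE//; apply: hX => //.
by apply: sub_sigma_algebra; exists t, B.
Qed.

Lemma measurable_counting_gt t n : (0 <= t)%R ->
  (measurable : set (set (g_sigma_algebraType (F t)))) [set w | (n < N t w)%N].
Proof.
move=> t0; have mNt := measurableT_comp measurable_fst (measurable_state t0).
by have := mNt measurableT [set k | (n < k)%N] I; rewrite setTI.
Qed.

Lemma counting_time_stopping n t : (0 <= t)%R ->
  F t [set w | counting_time N n w <= t%:E].
Proof.
move=> t0; rewrite -(filtration_measurableE hF)//.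
rewrite (_ : [set w | _] = [set w | (n < N t w)%N]); first exact: measurable_counting_gt.
by apply/seteqP; split => w /=; rewrite counting_time_le.
Qed.

Lemma measurable_counting_time n : measurable_fun setT (counting_time N n).
Proof.
apply: measurable_fun_ereal_le => r; have [r0|r0] := leP 0%R r.
  by have [_ mF _] := hF; apply: (mF r) => //; exact: counting_time_stopping.
rewrite (_ : [set w | _] = set0)// -subset0 => w /= /(le_trans (counting_time_ge0 _ _ _)).
by rewrite lee_fin leNgt r0.
Qed.

Lemma measurable_trunc_interarrival v n :
  measurable_fun setT (trunc_interarrival N v n).
Proof.
apply: measurableT_comp => //; apply: measurable_mine => //.
by apply: emeasurable_funB; exact: measurable_counting_time.
Qed.

(** The interval in progress at [t] ends in the future, but its end t + R(t) is known because the
    filtration contains the history of R. *)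
Lemma adapted_trunc_interarrival v n t : (0 <= t)%R ->
  measurable_fun ([set w | (n < N t w)%N] : set (g_sigma_algebraType (F t)))
    (trunc_interarrival N v n.+1).
Proof.
move=> t0.
(* On {n < N(t)} this equals t_{n+1}: either it has occurred by [t], or [N t w = n.+1] and it is the
   next counting time. *)
pose S w := if (n.+1 < N t w)%N then Order.min (counting_time N n.+1 w) t%:E
            else residual N t w + t%:E.
have mt k : measurable_fun (setT : set (g_sigma_algebraType (F t)))
    (fun w => Order.min (counting_time N k w) t%:E).
  apply: measurable_stopping_min => // [s s0|w].
    exact: counting_time_stopping.
  exact: counting_time_ge0.
have mS : measurable_fun (setT : set (g_sigma_algebraType (F t))) S.
  apply: measurable_fun_if => //.
  - apply: (measurable_fun_bool true); rewrite setTI preimage_true.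
    exact: measurable_counting_gt.
  - exact: measurable_funTS.
  - apply: measurable_funTS; apply: emeasurable_funD => //.
    exact: (measurableT_comp measurable_snd (measurable_state t0)).
have : measurable_fun (setT : set (g_sigma_algebraType (F t)))
    (fun w => fine (Order.min (S w - Order.min (counting_time N n w) t%:E) v%:E)).
  apply: measurableT_comp => //; apply: measurable_mine => //.
  exact: emeasurable_funB.
move=> mR; apply: eq_measurable_fun (measurable_funTS mR) => w; rewrite inE /= => nN.
rewrite /trunc_interarrival /interarrival /= /S; congr (fine (Order.min (_ - _) _)).
  have [nN'|Nn] := ltnP n.+1 (N t w).
    by rewrite min_l// counting_time_le.
  by rewrite residualE// subeK//; congr counting_time; apply/eqP; rewrite eqn_leq Nn.
by rewrite min_l// counting_time_le.
Qed.

Lemma adapted_strict_past (f : T -> R) n t : (0 <= t)%R ->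
  (forall B : set R, measurable B ->
    strict_past F (counting_time N n) (f @^-1` B)) ->
  measurable_fun ([set w | (n < N t w)%N] : set (g_sigma_algebraType (F t))) f.
Proof.
move=> t0 mf _ B mB; rewrite (filtration_measurableE hF)//.
rewrite (_ : [set w | _] = [set w | counting_time N n w <= t%:E]); last first.
  by apply/seteqP; split => w /=; rewrite counting_time_le.
rewrite setIC; apply: (strict_past_before hF) => //; last exact: mf.
by move=> s s0; exact: counting_time_stopping.
Qed.

End Adapted.

(** * Decomposition and martingale property *)

Theorem lemma5p1 (d : measure_display) (T : measurableType d) (R : realType)
  (P : probability T R) (N : R -> T -> nat) (F : R -> set (set T))
  (hN : counting_process N)
  (hF : filtration F)
  (hX : forall t : R, 0 <= t ->
    natural_sigma_algebra (state N) t `<=` F t)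
  (hX0 : forall w, state N 0 w = (1%N, interarrival N 1 w))
  (hTpos : forall n, (0 < n)%N -> {ae P, forall w, (0 < interarrival N n w)%E})
  (hTint : forall n, (0 < n)%N -> (\int[P]_w interarrival N n w < +oo)%E)
  (hNint : forall t : R, 0 <= t -> ('E_P[fun w => (N t w)%:R] < +oo)%E)
  (v : R) (hv : 0 < v)
  (C : nat -> T -> R)
  (hC : forall n, (0 < n)%N ->
    cond_expectation P (strict_past F (counting_time N n.-1))
      (trunc_interarrival N v n) (C n))
  (lam : R -> T -> R) (hlam : reciprocal_intensity N C lam) :
  (forall (t : R) (w : T), 0 <= t ->
    (N t w)%:R
    = \int[lebesgue_measure]_(s in `[0, t])
        (lam s w * ((residual N s w <= v%:E)%E)%:R)
      + lam t w * trunc_residual N v t w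
      + counting_martingale N v lam t w)
  /\ martingale P F (counting_martingale N v lam).
Proof.
have hN0 w : N 0 w = 1%N by have [] := hX0 w.
split; first exact: (fun t w => counting_decomposition hN hN0 hlam w hv).
have [_ mF _] := hF.
(* The index is shifted by one: [D n] belongs to the interval that starts at t_n and enters the sum
   exactly when [n < N t w]. *)
pose D n w := 1 - trunc_interarrival N v n.+1 w / C n.+1 w.
pose S t w := \sum_(0 <= n < N t w) D n w.
have ME t : 0 <= t -> counting_martingale N v lam t = S t.
  move=> t0; apply/funext => w.
  by rewrite (counting_martingaleE hN hlam)// big_add1.
have stop n := fun s (s0 : 0 <= s) => counting_time_stopping hN hF hX n s0.
have mG n := sub_strict_past hF (stop n).
have sG n : sigma_algebra setT (strict_past F (counting_time N n)).
  exact: smallest_sigma_algebra.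
have mT n := measurable_trunc_interarrival hN hF hX v n.
have T0 n w : 0 <= trunc_interarrival N v n w.
  exact: trunc_interarrival_ge0.
have Tpos n : {ae P, forall w, 0 < trunc_interarrival N v n.+1 w}.
  have := hTpos n.+1 isT; apply: filterS => w.
  rewrite /trunc_interarrival; case: (interarrival N n.+1 w) => [r||]//=.
  by rewrite lte_fin -EFin_min /= lt_min hv andbT.
have D_int n A := integral_onem_div_cond_expectation (sG n) (@mG n) (hC n.+1 isT)
  (mT n.+1) (T0 n.+1) (Tpos n) (A := A).
have D_norm n A := integral_norm_onem_div_cond_expectation (sG n) (@mG n) (hC n.+1 isT)
  (mT n.+1) (T0 n.+1) (Tpos n) (A := A).
have mC n : measurable_fun setT (C n.+1).
  by move=> _ B mB; rewrite setTI; apply: (mG n); have [+ _ _] := hC n.+1 isT; exact.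
have mD n : measurable_fun setT (D n).
  by apply: measurable_funB => //; apply: measurable_funM => //; exact: measurable_funV.
have NE t n : 0 <= t ->
    [set w | (n < N t w)%N] = [set w | (counting_time N n w <= t%:E)%E].
  by move=> t0; apply/seteqP; split => w /=; rewrite (counting_time_le hN).
have adaptedM t : 0 <= t -> forall B, measurable B -> F t (S t @^-1` B).
  move=> t0 B mB; rewrite -(filtration_measurableE hF)// -[_ @^-1` _]setTI.
  apply: (measurable_random_sum (T := g_sigma_algebraType (F t))) => // n.
    exact: (measurable_counting_gt hF hX).
  apply: measurable_funB => //; apply: measurable_funM.
    exact: (adapted_trunc_interarrival hN hF hX hN0).
  apply: measurable_funV; apply: (adapted_strict_past hN hF hX) => //.
  by have [+ _ _] := hC n.+1 isT.
have SC t : 0 <= t -> P.-integrable setT (EFin \o S t) /\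
    forall A, measurable A ->
    (\sum_(0 <= n < m) \int[P]_(w in A `&` [set w | (n < N t w)%N]) (D n w)%:E
      @[m --> \oo] --> \int[P]_(w in A) (S t w)%:E)%E.
  (* The constant 2 comes from [D_norm], applied to {t_n <= t}, which lies in the strict past of
     t_n. *)
  move=> t0; apply: (@integral_random_sum _ _ _ _ D _ P 2) => //.
  - move=> n; rewrite NE//; exact: (mF t _ _ (stop n t t0)).
  - by move=> n; apply: D_norm; rewrite NE//; exact: strict_past_le.
  - by have := hNint t t0; rewrite unlock.
split=> [t t0|t t0|s t s0 st]; first by rewrite ME//; exact: adaptedM.
  by rewrite ME//; have [] := SC t t0.
have t0 := le_trans s0 st.
rewrite !ME//; split; [exact: adaptedM|by have [] := SC s s0|move=> A FA].
have mA := mF s s0 A FA.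
have [_ /(_ A mA) cs] := SC s s0; have [_ /(_ A mA) ct] := SC t t0.
(* The integrals at times [s] and [t] are limits of series, which are shown to agree term by
   term. *)
apply: cvg_unique cs _ => //.
suff -> : (fun m => \sum_(0 <= n < m)
    \int[P]_(w in A `&` [set w | (n < N s w)%N]) (D n w)%:E)%E =
  (fun m => \sum_(0 <= n < m)
    \int[P]_(w in A `&` [set w | (n < N t w)%N]) (D n w)%:E)%E by [].
apply/funext => m; apply: eq_bigr => n _.
(* [B] is what is gained on passing from {n < N(s)} to {n < N(t)} within [A]. As [A] is in F_s, its
   part in {s < t_n} is a generator of the strict past, so [D n] integrates to 0 over [B]. *)
pose B := A `&` [set w | (s%:E < counting_time N n w)%E]
            `&` [set w | (counting_time N n w <= t%:E)%E].
have GB : strict_past F (counting_time N n) B.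
  rewrite -(measurable_g_measurableTypeE (sG n)); apply: measurableI;
    rewrite (measurable_g_measurableTypeE (sG n)).
    exact: strict_past_gt.
  exact: strict_past_le.
have -> : A `&` [set w | (n < N t w)%N] = (A `&` [set w | (n < N s w)%N]) `|` B.
  rewrite !NE//; apply/seteqP; split => w /=.
    by move=> [Aw tw]; have [|] := leP (counting_time N n w) s%:E; [left|right].
  by move=> [[Aw sw]|[[]]//]; split => //; rewrite (le_trans sw)// lee_fin.
rewrite integral_setU//.
- by rewrite (D_int n _ GB) addr0.
- by apply: measurableI => //; rewrite NE//; exact: (mF s _ _ (stop n s s0)).
- exact: (mG n _ GB).
- exact/measurable_EFinP/measurable_funTS.
- apply/disj_setPS => w [[_ sw]] [[_ sw'] _].
  by move: sw sw'; rewrite /= (counting_time_gt hN)// ltnNge => /negP.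
Qed.
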